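(* Let $G$ be the finite simple graph with vertex set $\{1,2,\ldots,10\}$ and edge set $$\{\{1,2\},\{1,10\},\{2,4\},\{3,4\},\{3,6\},\{4,5\},\{5,7\},\{5,10\},\{6,10\},\{7,9\},\{8,10\}\}.$$ Then $G$ is connected and nontrivially unstable, but there is no odd integer $k$ for which $G$ contains both a cycle $C_k$ and a cycle $C_{2k}$.
   Context: All graphs are finite, simple and undirected. For a graph $G$, $N(v)$ denotes the open neighbourhood of the vertex $v$. The canonical double cover of $G$ is the graph with vertex set $V(G)\times\{0,1\}$ in which $(u,0)$ and $(v,1)$ are adjacent if and only if $uv\in E(G)$, with no other edges. The group $\operatorname{Aut}(G)\times\mathbb{Z}_2$ embeds in the automorphism group of the canonical double cover: $\varphi\in\operatorname{Aut}(G)$ acts by $(v,i)\mapsto(\varphi(v),i)$, and the generator of $\mathbb{Z}_2$ acts by $(v,i)\mapsto(v,1-i)$. The graph $G$ is unstable if the automorphism group of its canonical double cover is strictly larger than this subgroup $\operatorname{Aut}(G)\times\mathbb{Z}_2$, i.e. if some automorphism of the canonical double cover does not belong to it. A graph is vertex-determining if distinct vertices have distinct open neighbourhoods. A graph is nontrivially unstable if it is unstable, nonbipartite and vertex-determining. $C_k$ denotes the simple cycle on $k$ vertices ($k\ge 3$); ''$G$ contains $C_k$'' means that $G$ has a (not necessarily induced) subgraph isomorphic to $C_k$, that is, a simple cycle of length $k$. *)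

(* Defs.v *)
From HB Require Import structures.
From mathcomp Require Import all_boot all_fingroup.

Set Implicit Arguments.
Unset Strict Implicit.
Unset Printing Implicit Defensive.

Structure sgraph := SGraph {
  svertex :> finType;
  adj : rel svertex;
  adj_sym : symmetric adj;
  adj_irr : irreflexive adj
}.

Section Notions.
Variable G : sgraph.

Definition nbh (v : G) : {set G} := [set u | adj v u].

Definition connected : Prop :=
  0 < #|G| /\ forall u v : G, connect (@adj G) u v.

Definition bipartite : Prop :=
  exists c : G -> bool, forall u v : G, adj u v -> c u != c v.

Definition vertex_determining : Prop := injective nbh.

(* [ucycle] alone also accepts sequences of length 0 and 2, hence [2 < k]. *)
Definition contains_cycle (k : nat) : Prop :=
  2 < k /\ exists c : seq G, size c = k /\ ucycle (@adj G) c.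

Definition graph_aut : {set {perm G}} :=
  [set s : {perm G} | [forall u, forall v, adj (s u) (s v) == adj u v]].

Lemma graph_aut_group_set : group_set graph_aut.
Proof.
apply/group_setP; split=> [|s t].
  by rewrite inE; apply/forallP => u; apply/forallP => v; rewrite !perm1.
rewrite !inE => /forallP hs /forallP ht.
apply/forallP => u; apply/forallP => v; rewrite !permM.
by rewrite (eqP (forallP (ht _) _)) (forallP (hs _) _).
Qed.

Canonical graph_aut_group := Group graph_aut_group_set.

(* The layers 0 and 1 of the canonical double cover are [false] and [true]. *)
Definition cdc_adj (x y : G * bool) : bool := adj x.1 y.1 && (x.2 != y.2).

Lemma cdc_adj_sym : symmetric cdc_adj.
Proof. by move=> x y; rewrite /cdc_adj adj_sym eq_sym. Qed.

Lemma cdc_adj_irr : irreflexive cdc_adj.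
Proof. by move=> x; rewrite /cdc_adj adj_irr. Qed.

Definition cdc : sgraph := SGraph cdc_adj_sym cdc_adj_irr.

Definition cdc_lift_fun (s : {perm G}) (b : bool) (x : cdc) : cdc :=
  (s x.1, b (+) x.2).

Lemma cdc_lift_inj (s : {perm G}) (b : bool) : injective (cdc_lift_fun s b).
Proof. by move=> [u i] [v j] [/perm_inj-> /addbI->]. Qed.

(* The action of the pair (s, b) of Aut(G) x Z_2 on the double cover. *)
Definition cdc_lift (s : {perm G}) (b : bool) : {perm cdc} :=
  perm (@cdc_lift_inj s b).

Definition expected_aut : {set {perm cdc}} :=
  [set cdc_lift s b | s in graph_aut, b in [set: bool]].

End Notions.

Lemma expected_aut_sub (G : sgraph) : expected_aut G \subset graph_aut (cdc G).
Proof.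
apply/subsetP => _ /imset2P[s b hs _ ->]; move: hs; rewrite !inE => /forallP hs.
apply/forallP => x; apply/forallP => y; rewrite !permE /= /cdc_adj /=.
by rewrite (eqP (forallP (hs _) _)) (inj_eq (@addbI b)).
Qed.

Definition unstable (G : sgraph) : Prop :=
  expected_aut G \proper graph_aut (cdc G).

Definition nontrivially_unstable (G : sgraph) : Prop :=
  [/\ unstable G, ~ bipartite G & vertex_determining G].

Definition G10_edges : seq (nat * nat) :=
  [:: (1, 2); (1, 10); (2, 4); (3, 4); (3, 6); (4, 5);
      (5, 7); (5, 10); (6, 10); (7, 9); (8, 10)].

(* The vertex labelled k in {1, ..., 10} is the ordinal k - 1 of 'I_10. *)
Definition G10_adj (u v : 'I_10) : bool :=
  ((u.+1, v.+1) \in G10_edges) || ((v.+1, u.+1) \in G10_edges).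

Lemma G10_adj_sym : symmetric G10_adj.
Proof. by move=> u v; rewrite /G10_adj orbC. Qed.

Lemma G10_adj_irr : irreflexive G10_adj.
Proof. by case; do 10?case=> //. Qed.

Definition G10 : sgraph := SGraph G10_adj_sym G10_adj_irr.

(* Main.v *)
Require Import Defs.
From mathcomp Require Import all_boot all_fingroup.

(** The vertices 4 and 10 are joined by the three internally disjoint paths
    4-2-1-10, 4-3-6-10 and 4-5-10; the rest of the graph is the path 5-7-9 and
    the pendant edge 8-10, which lie on no cycle.

    Instability.  The product of the swaps (1 6) and (2 3) interchanges the two
    long paths between 4 and 10, so it is an automorphism of the graph.  In the double cover the edges from {1, 6} x {0} to {2, 3} x {1} are
    separate from those from {2, 3} x {0} to {1, 6} x {1}, so one may apply
    (1 6) on layer 0 and (2 3) on layer 1 only: every edge of the double cover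
    is preserved, but the permutations of the two layers differ
    ([two_fold_unstable]), so this does not come from Aut(G) x Z_2.

    Cycles.  The cycles of the graph have lengths 5, 5 and 6.  An odd k with
    cycles of lengths k and 2k satisfies 2k <= 10, hence is 3 or 5.  There is no
    triangle; and a cycle of length 10 would pass through every vertex, in
    particular through the leaf 8, while a vertex on a cycle has two neighbours
    ([ucycle_two_nbrs]). *)

Set Implicit Arguments.
Unset Strict Implicit.
Unset Printing Implicit Defensive.

Section General.
Variable G : sgraph.

(** Rotating the cycle so that it starts at [x], the two neighbours are the
    second and the last vertex; they differ because there is a third one. *)
Lemma ucycle_two_nbrs (c : seq G) (x : G) :
  ucycle (@adj G) c -> 2 < size c -> x \in c ->
  exists u v : G, [/\ u != v, adj x u & adj x v].
Proof.
move=> cyc_c lt2c /rot_to[i p def_c].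
have: ucycle (@adj G) (rot i c) by rewrite /ucycle rot_cycle rot_uniq.
have: 2 < size (rot i c) by rewrite size_rot.
rewrite def_c; case: p {def_c} => [|y [|z p]] // _.
rewrite /ucycle /= rcons_path => /andP[/andP[xy /andP[_ /andP[_ lx]]]].
case/and3P=> _ yNzp _; exists y, (last z p); split=> //.
- by apply: contraNneq yNzp => ->; rewrite mem_last.
- by rewrite adj_sym.
Qed.

Section Layers.
Variables a b : {perm G}.

Definition layer_fun (x : cdc G) : cdc G :=
  ((if x.2 then b else a) x.1, x.2).

Lemma layer_fun_inj : injective layer_fun.
Proof. by move=> [u i] [v j] [+ eq_ij]; rewrite -eq_ij => /perm_inj->. Qed.

Definition layer_perm : {perm cdc G} := perm layer_fun_inj.

(** The hypothesis says that applying [a] on layer 0 and [b] on layer 1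
    preserves the edges of the double cover.  An element of Aut(G) x Z_2 acts
    by the same permutation of V(G) on both layers. *)
Lemma two_fold_unstable :
  (forall u v : G, adj (a u) (b v) = adj u v) -> a != b -> unstable G.
Proof.
move=> adj_ab a_neq_b; apply/properP; split; first exact: expected_aut_sub.
exists layer_perm.
  rewrite inE; apply/forallP => -[u i]; apply/forallP => -[v j].
  rewrite !permE /= /cdc_adj /=; case: i j => [] [] /=; rewrite ?andbF //.
  - by rewrite adj_sym adj_ab adj_sym.
  - by rewrite adj_ab.
apply: contraNN a_neq_b => /imset2P[s i _ _ eq_s]; apply/eqP/permP => u.
have eq_on (j : bool) := congr1 (fun t : {perm cdc G} => (t (u, j)).1) eq_s.
have := eq_on true; have := eq_on false.
by rewrite !permE /= => -> ->.
Qed.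

End Layers.
End General.

(** The vertex labelled [k], for [k] in {1, ..., 10}.  The reduction modulo 10
    makes the definition total and lets closed terms evaluate. *)
Definition lbl (k : nat) : G10 := Ordinal (ltn_pmod k.-1 (isT : 0 < 10)).

(** Reduces a statement about all vertices to a closed boolean computation. *)
Lemma G10_forall (P : pred G10) :
  all P [seq lbl k | k <- iota 1 10] -> forall u, P u.
Proof.
move=> /allP allP u; apply: allP; apply/mapP; exists u.+1.
  by rewrite mem_iota /= ltnS.
by apply: val_inj; rewrite /= modn_small.
Qed.

Lemma G10_forall2 (P : rel G10) :
  all (fun u => all (P u) [seq lbl k | k <- iota 1 10])
      [seq lbl k | k <- iota 1 10] ->
  forall u v, P u v.
Proof. by move=> P_all u; apply: G10_forall; move: u; apply: G10_forall. Qed.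

Lemma G10_connected : connected G10.
Proof.
split; first by rewrite card_ord.
(* A walk from the leaf 8 to the leaf 9 through every vertex. *)
pose w := [seq lbl k | k <- [:: 10; 6; 3; 4; 2; 1; 10; 5; 7; 9]].
have from8 : forall u, connect (@adj G10) (lbl 8) u.
  move=> u; apply: (@path_connect _ _ _ w); first by vm_compute.
  by move: u; apply: G10_forall; vm_compute.
move=> u v; apply: connect_trans (from8 v).
by rewrite (sym_connect_sym (@adj_sym G10)).
Qed.

Lemma G10_not_bipartite : ~ bipartite G10.
Proof.
case=> c col.
(* The 5-cycle 1-2-4-5-10 cannot be properly 2-coloured. *)
have := col (lbl 1) (lbl 2) isT; have := col (lbl 2) (lbl 4) isT.
have := col (lbl 4) (lbl 5) isT; have := col (lbl 5) (lbl 10) isT.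
have := col (lbl 10) (lbl 1) isT.
by case: (c (lbl 1)); case: (c (lbl 2)); case: (c (lbl 4)); case: (c (lbl 5));
   case: (c (lbl 10)).
Qed.

Lemma G10_vertex_determining : vertex_determining G10.
Proof.
pose same_nbh (u v : G10) :=
  all (fun w => adj u w == adj v w) [seq lbl k | k <- iota 1 10].
have det : forall u v, same_nbh u v ==> (u == v).
  by apply: G10_forall2; vm_compute.
move=> u v /setP eq_nbh; apply/eqP; apply: (implyP (det u v)).
by apply/allP => w _; have := eq_nbh w; rewrite !inE => ->.
Qed.

Lemma G10_unstable : unstable G10.
Proof.
apply: (@two_fold_unstable _ (tperm (lbl 1) (lbl 6)) (tperm (lbl 2) (lbl 3))).
  move=> u v; rewrite !permE; apply/eqP; move: u v.
  by apply: G10_forall2; vm_compute.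
by apply/eqP => /permP/(_ (lbl 1)); rewrite tpermL tpermD.
Qed.

Lemma G10_no_triangle : ~ contains_cycle G10 3.
Proof.
case=> _ [c [+ /andP[+ _]]]; case: c => [|x [|y [|z []]]] //= _.
have no_tri : forall u v,
    adj u v ==> all (fun w => ~~ (adj v w && adj w u))
                    [seq lbl k | k <- iota 1 10].
  by apply: G10_forall2; vm_compute.
case/and4P=> xy yz zx _; have /negP[] := G10_forall (implyP (no_tri x y) xy) z.
by apply/andP.
Qed.

Lemma G10_no_hamiltonian_cycle : ~ contains_cycle G10 10.
Proof.
case=> _ [c [size_c cyc_c]]; have /andP[_ uniq_c] := cyc_c.
have leaf_in_c : lbl 8 \in c.
  have /card_uniqP card_c := uniq_c.
  have /(@subset_cardP _ _ _)/(_ (subset_predT _)) -> // : #|c| = #|G10|.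
  by rewrite card_c size_c card_ord.
have [|u [v [u_neq_v]]] := ucycle_two_nbrs cyc_c _ leaf_in_c.
  by rewrite size_c.
have leaf : forall w : G10, adj (lbl 8) w ==> (w == lbl 10).
  by apply: G10_forall; vm_compute.
move=> /(implyP (leaf u))/eqP eq_u /(implyP (leaf v))/eqP eq_v.
by rewrite eq_u eq_v eqxx in u_neq_v.
Qed.

Theorem theorem1 :
  [/\ connected G10,
      nontrivially_unstable G10
    & ~ exists k : nat,
        [/\ odd k, contains_cycle G10 k & contains_cycle G10 (2 * k)]].
Proof.
split; first exact: G10_connected.
  split; [exact: G10_unstable | exact: G10_not_bipartite |].
  exact: G10_vertex_determining.
case=> k [odd_k cyc_k cyc_2k].
have le_k5 : k <= 5.
  have [_ [c [size_c /andP[_ /card_uniqP card_c]]]] := cyc_2k.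
  rewrite -(@leq_pmul2l 2) //.
  by have := max_card (mem c); rewrite card_c size_c card_ord.
have [lt2k _] := cyc_k.
case: k odd_k cyc_k cyc_2k le_k5 lt2k => [|[|[|[|[|[|k]]]]]] // _ cyc_k cyc_2k _ _.
- exact: G10_no_triangle.
- exact: G10_no_hamiltonian_cycle.
Qed.
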